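(* Consider a planar directed network on a disc with $n_1+m$ sources separated from $m+n_2$ sinks, let $\mathcal M$ be its quantum transport matrix with entries in $Q$, and let $M_{11}$ ($m\times n_1$), $M_{12}$ ($m\times m$), $M_{21}$ ($n_2\times n_1$), $M_{22}$ ($n_2\times m$) be its blocks. Define the level-$k$ quantum transport matrices (of size $n_2\times n_1$) $$T_0=M_{21},\qquad T_1=M_{22}M_{11},\qquad T_{k+1}=M_{22}[M_{12}]^{k}M_{11}\quad (k\ge 1).$$ Then for all integers $k\ge p\ge 0$, $$R\,\overset{1}{T}_k\overset{2}{T}_p+(q-q^{-1})P\sum_{l=1}^{p}\overset{1}{T}_{k+l}\overset{2}{T}_{p-l}-\overset{2}{T}_p\overset{1}{T}_k R-\sum_{l=1}^{p}\overset{2}{T}_{p-l}\overset{1}{T}_{k+l}\,(q-q^{-1})P=0 .$$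
   Context: **Network and quantum transport matrix.** Let $q\in\mathbb C^*$ (with a fixed choice of $q^{1/2}$). A planar directed network on a disc is a directed graph embedded in the disc with finitely many boundary univalent vertices (sources, with the edge directed inwards, and sinks, with the edge directed outwards) and inner trivalent vertices having either one incoming and two outgoing edges (''gray'') or two incoming and one outgoing edge (''black''); directed cycles are allowed. To every face (inner or boundary) $i$ of the network a variable $\omega_i$ is assigned, with $q^{\varepsilon_{ij}}\omega_i\omega_j=q^{-\varepsilon_{ij}}\omega_j\omega_i$, where $\varepsilon_{ij}=-\varepsilon_{ji}$ is the exchange matrix of the dual quiver: $\varepsilon$ is the sum over inner vertices of contributions $\varepsilon_{XY}=\varepsilon_{YZ}=\varepsilon_{ZX}=\tfrac12$ (antisymmetrized), where $X,Y,Z$ are the three faces around the vertex listed clockwise for a gray vertex and counterclockwise for a black vertex. $Q$ denotes the algebra (skew field of fractions of the quantum torus, or a suitable completion) containing all the $\omega_i$. The Weyl-ordered product is $:\!\omega_{i_1}\cdots\omega_{i_r}\!:\;=q^{\sum_{a<b}\varepsilon_{i_ai_b}}\omega_{i_1}\cdots\omega_{i_r}$. For a source $a$ and a sink $c$, $$T_{a\to c}=\sum_{\text{directed paths } a\to c}(-1)^{\#\text{self-intersections}}\; :\!\prod_{\text{faces to the right of the path}}\omega_i\!:\ ,$$ where paths with repetitions and self-intersections are included and faces are counted with multiplicity; for networks with cycles the sum may be infinite and is understood as the resulting rational expression. All sources are separated from all sinks along the boundary of the disc. There are $n_1+m$ sources, ordered clockwise (first $n_1$, then $m$), and $m+n_2$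 sinks, ordered counterclockwise (first $m$, then $n_2$). With $\mathcal M_{i,j}=T_{a_j\to c_i}$, the $(m+n_2)\times(n_1+m)$ transport matrix has the block form $\mathcal M=\begin{pmatrix}M_{11}&M_{12}\\ M_{21}&M_{22}\end{pmatrix}$ with row blocks of sizes $m,n_2$ and column blocks of sizes $n_1,m$. **$R$-matrix.** For each size $k$, $$R=R_k=\sum_{1\le i,j\le k}e_{ii}\otimes e_{jj}+(q-1)\sum_{1\le i\le k}e_{ii}\otimes e_{ii}+(q-q^{-1})\sum_{1\le j<i\le k}e_{ij}\otimes e_{ji},$$ acting on $V_k\otimes V_k$, $V_k=\mathbb C^k$; $P=\sum_{i,j}e_{ij}\otimes e_{ji}$ is the permutation matrix. It is an established fact (standing input) that the quantum transport matrix satisfies $$R_{m+n_2}\overset{1}{\mathcal M}\overset{2}{\mathcal M}=\overset{2}{\mathcal M}\overset{1}{\mathcal M}R_{n_1+m}.$$ **Conventions.** A number over a matrix indicates the tensor factor in which it acts (e.g. $\overset{1}{M}=\sum e_{ij}\otimes I\otimes M_{ij}$). Entries in $Q$ are multiplied in the order in which the matrices are written. The entries of $R$ and $P$ are scalars; their sizes are determined by the position: $R$, $P$ act on $V_{n_2}\otimes V_{n_2}$ to the left of products of $T$'s and on $V_{n_1}\otimes V_{n_1}$ to the right. Empty sums are zero. *)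

(* Defs.v *)
From HB Require Import structures.
From mathcomp Require Import all_boot all_order all_algebra.
From mathcomp Require Import boolp classical_sets reals.
From mathcomp.real_closed Require Import complex mxtens.

Set Implicit Arguments.
Unset Strict Implicit.
Unset Printing Implicit Defensive.
Import Order.TTheory GRing.Theory Num.Theory.
Local Open Scope ring_scope.

(** * Planar directed networks on a disc

  A network with [N] sources and [K] sinks is encoded by its half-edges.
  Every inner vertex [w] has the three half-edges [(w, 0), (w, 1), (w, 2)],
  listed clockwise, where [(w, 0)] is the one whose direction differs from the
  other two: the incoming edge of a gray vertex, the outgoing edge of a black
  one.  A boundary vertex has a single half-edge. *)

Definition half_edge (N K : nat) (W : finType) : finType :=
  (('I_N + 'I_K) + (W * 'I_3))%type.

Section HalfEdges.
Variables (N K : nat) (W : finType) (gray : pred W).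
Local Notation H := (half_edge N K W).

Definition source_half (j : 'I_N) : H := inl (inl j).
Definition sink_half (i : 'I_K) : H := inl (inr i).

Definition outgoing (h : H) : bool :=
  match h with
  | inl (inl _) => true
  | inl (inr _) => false
  | inr (w, k) => if gray w then val k != 0%N else val k == 0%N
  end.

(** The boundary half-edges in counterclockwise order along the disc: the
  sources are numbered clockwise, the sinks counterclockwise, and all sources
  precede all sinks. *)
Definition boundary_cycle : seq ('I_N + 'I_K) :=
  rev [seq inl j | j <- enum 'I_N] ++ [seq inr i | i <- enum 'I_K].

(** Collapsing the boundary circle of the disc to one point turns the disc into
  a sphere, without changing the faces.  [turn] is the clockwise rotation of
  half-edges around each vertex of the resulting graph; around the collapsed
  boundary, clockwise on the sphere is counterclockwise along the disc. *)
Definition turn (h : H) : H :=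
  match h with
  | inl b => inl (next boundary_cycle b)
  | inr (w, k) => inr (w, ordS k)
  end.

End HalfEdges.

(** [partner h] is the other half of the edge containing [h], and [face h] is
  the face to the right of that edge when it is traversed starting from [h],
  i.e. the face containing the corner between [h] and [turn h].

  The boundary components of the faces are the orbits of
  [partner \o turn]; a face has several of them when the graph is disconnected.
  If every face is a sphere with as many holes as it has boundary components,
  gluing the faces along the graph yields a closed oriented surface: it is
  connected by [face_connected], and [planar] says that its Euler
  characteristic
    #vertices - #edges + \sum_(f : face) (2 - #boundary components of f)
  is 2, i.e. that it is the sphere. *)
Record network (N K : nat) := Network {
  inner : finType;
  gray : pred inner;
  partner : half_edge N K inner -> half_edge N K inner;
  partnerK : involutive partner;
  partner_dir : forall h, outgoing gray (partner h) = ~~ outgoing gray h;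
  face_of : finType;
  face : half_edge N K inner -> face_of;
  face_corner : forall h, face (partner (turn h)) = face h;
  face_exists : (0 < #|face_of|)%N;
  face_connected : forall f g : face_of,
    connect [rel f' g' | [exists h, (face h == f') && (face (partner h) == g')]]
            f g;
  planar :
    (fcard (@turn N K inner) predT + 2 * #|face_of|
       = 2 + #|[pred h : half_edge N K inner | outgoing gray h]| + fcard (partner \o @turn N K inner) predT)%N
}.

(** * The exchange matrix and the quantum torus *)

Section QuantumTorus.
Variables (N K : nat) (net : network N K).
Local Notation F := (face_of net).

(** [eps2] is twice the exchange matrix [eps], hence integral.  The faces around
  [w] in clockwise order are [face (w, 0)], [face (w, 1)], [face (w, 2)]. *)
Definition eps2 (f g : F) : int :=
  \sum_(w : inner net) \sum_(k < 3)
    (-1) ^+ (~~ gray w) *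
    let X := face (inr (w, k) : half_edge N K (inner net)) in
    let Y := face (inr (w, ordS k) : half_edge N K (inner net)) in
    (((X == f) && (Y == g))%:Z - ((X == g) && (Y == f))%:Z).

Variables (C : fieldType) (qh : C) (Q : unitAlgType C) (omega : F -> Q).

(** The Weyl-ordered monomial with exponents [n]; [qh] is the chosen square root
  of [q], so that [q ^ eps f g = qh ^ eps2 f g]. *)
Definition weyl (n : F -> int) : Q :=
  qh ^ (\sum_(f : F) \sum_(g : F | (enum_rank f < enum_rank g)%N)
          eps2 f g * n f * n g)
  *: \prod_(f <- enum F) omega f ^ n f.

(** [Q] contains the quantum torus generated by the invertible face variables:
  they [q]-commute and the Weyl monomials are linearly independent. *)
Record face_variables : Prop := FaceVariables {
  omega_unit : forall f, omega f \is a GRing.unit;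
  omega_comm : forall f g, qh ^ eps2 f g *: (omega f * omega g)
                         = qh ^ (- eps2 f g) *: (omega g * omega f);
  omega_free : forall (s : seq {ffun F -> int}) (c : {ffun F -> int} -> C),
    uniq s -> \sum_(n <- s) c n *: weyl n = 0 -> {in s, forall n, c n = 0}
}.

End QuantumTorus.

(** * Directed paths and the transport matrix *)

Section Transport.
Variables (N K : nat) (net : network N K).
Local Notation H := (half_edge N K (inner net)).
Local Notation F := (face_of net).

Definition same_inner_vertex (h h' : H) : bool :=
  match h, h' with inr (w, _), inr (w', _) => w == w' | _, _ => false end.

(** An edge is designated by its outgoing half-edge, and a directed path by the
  sequence of its edges. *)
Definition consecutive (h h' : H) : bool :=
  outgoing (@gray _ _ net) h' && same_inner_vertex (partner h) h'.

Definition directed_path (a : 'I_N) (c : 'I_K) (p : seq H) : bool :=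
  if p is h :: p' then
    [&& h == source_half K (inner net) a, path consecutive h p'
      & partner (last h p') == sink_half N (inner net) c]
  else false.

(** The multiplicity of a face is the number of times it lies to the right of
  the path, i.e. the winding number around it of the closed curve made of the
  path followed by the boundary arc to its right.  It drops by one at each
  crossing of a path edge from right to left, and vanishes to the left of
  the initial edge.  It can be negative for a path turning counterclockwise
  around a cycle. *)
Definition right_multiplicities (a : 'I_N) (p : seq H) (n : {ffun F -> int}) :
    Prop :=
  (forall h, outgoing (@gray _ _ net) h ->
     n (face h) = n (face (partner h)) + (count_mem h p)%:Z) /\
  n (face (partner (source_half K (inner net) a))) = 0.

Definition right_faces (a : 'I_N) (p : seq H) : {ffun F -> int} :=
  xget [ffun=> 0] [set n | right_multiplicities a p n]%classic.

Definition slot (h : H) : nat := if h is inr (_, k) then val k else 0%N.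

(** Two passages of a path meet along maximal common stretches: they come
  together at a black vertex, run along [l > 0] common edges and part at a gray
  vertex.  By the clockwise numbering of half-edges, slot 1 of a black vertex
  comes in from the right and slot 2 from the left, while slot 1 of a gray
  vertex leaves to the left and slot 2 to the right.  Hence the passages cross
  exactly when one of them comes in and leaves through equal slots. *)
Definition crossing (h0 : H) (p : seq H) (i j l : nat) : bool :=
  let e := nth h0 p in
  [&& (i < j)%N, (0 < l)%N, (j + l.+1 < size p)%N,
      e i != e j,
      [forall t : 'I_l, e (i + t.+1)%N == e (j + t.+1)%N],
      e (i + l.+1)%N != e (j + l.+1)%N
    & slot (partner (e i)) == slot (e (i + l.+1)%N)].

Definition self_intersections (a : 'I_N) (p : seq H) : nat :=
  #|[set x : 'I_(size p) * 'I_(size p) * 'I_(size p) |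
      crossing (source_half K (inner net) a) p x.1.1 x.1.2 x.2]|.

Variables (C : fieldType) (qh : C) (Q : unitAlgType C) (omega : F -> Q).

(** The finite part of the path sum given by the paths with [d] edges. *)
Definition transport_part (a : 'I_N) (c : 'I_K) (d : nat) : Q :=
  \sum_(p : d.-tuple H | directed_path a c p)
    (-1) ^+ self_intersections a p *: weyl qh omega (right_faces a p).

(** [v] is the value at [t = 1] of the rational expression whose expansion is
  the power series [\sum_d u d t^d] in a central variable [t]: the series equals
  [A(t)^-1 B(t)] for polynomials [A], [B] with [A(1)] invertible.  When only
  finitely many [u d] are nonzero, [A = 1] gives the plain sum. *)
Definition rational_sum (u : nat -> Q) (v : Q) : Prop :=
  exists A B : {poly Q},
    [/\ forall d, \sum_(k < d.+1) A`_k * u (d - k)%N = B`_d,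
        A.[1] \is a GRing.unit
      & A.[1] * v = B.[1]].

Definition transport_matrix (M : 'M[Q]_(K, N)) : Prop :=
  forall i j, rational_sum (transport_part j i) (M i j).

End Transport.

(** * Matrices on tensor squares *)

Section TensorLegs.
Variables (C : fieldType) (Q : unitAlgType C).

(** The operators on a tensor product of two spaces acting as [A] on the first,
  resp. second, factor; the other factor has dimension [k]. *)
Definition leg1 (k : nat) {a b : nat} (A : 'M[Q]_(a, b)) : 'M[Q]_(a * k, b * k) :=
  A *t (1%:M : 'M[Q]_k).
Definition leg2 (k : nat) {a b : nat} (A : 'M[Q]_(a, b)) : 'M[Q]_(k * a, k * b) :=
  (1%:M : 'M[Q]_k) *t A.

(** Entries are multiplied in the written order:
  [prod12 A B] is A in leg 1 times B in leg 2, with entries [A i j * B k l];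
  [prod21 B A] is B in leg 2 times A in leg 1, with entries [B k l * A i j]. *)
Definition prod12 {a b c d : nat} (A : 'M[Q]_(a, b)) (B : 'M[Q]_(c, d)) :
    'M[Q]_(a * c, b * d) := leg1 c A *m leg2 b B.
Definition prod21 {a b c d : nat} (B : 'M[Q]_(c, d)) (A : 'M[Q]_(a, b)) :
    'M[Q]_(a * c, b * d) := leg2 a B *m leg1 d A.

Definition Rmx (q : C) (k : nat) : 'M[C]_(k * k) :=
  \sum_(i < k) \sum_(j < k) delta_mx i i *t delta_mx j j
  + (q - 1) *: \sum_(i < k) delta_mx i i *t delta_mx i i
  + (q - q^-1) *: \sum_(i < k) \sum_(j < k | (j < i)%N) delta_mx i j *t delta_mx j i.

Definition Pmx (k : nat) : 'M[C]_(k * k) :=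
  \sum_(i < k) \sum_(j < k) delta_mx i j *t delta_mx j i.

Definition scalar_entries {a b : nat} (A : 'M[C]_(a, b)) : 'M[Q]_(a, b) :=
  map_mx (fun x : C => x%:A) A.

Definition RTT (q : C) {a b : nat} (M : 'M[Q]_(a, b)) : Prop :=
  scalar_entries (Rmx q a) *m prod12 M M = prod21 M M *m scalar_entries (Rmx q b).

Definition level_transport {m n1 n2 : nat} (M : 'M[Q]_(m + n2, n1 + m)) (k : nat) :
    'M[Q]_(n2, n1) :=
  if k is k'.+1 then drsubmx M *m ursubmx M ^+ k' *m ulsubmx M else dlsubmx M.

End TensorLegs.

(* Main.v *)
(** Put [g = P R] and write [X (x) Y] for the matrix with entries [X i k * Y j l].
  Multiplied by [P], the claim says that
    [g T_k (x) T_p + (q - q^-1) \sum_l T_(k+l) (x) T_(p-l)]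
  is unchanged when in each product the factors of [(x)] are exchanged and [g]
  moves to the other side.
  With A, B, C, D the blocks M11, M12, M21, M22 and b = (B (x) 1) P, the block
  relations contained in RTT give
    [T_(i+1) (x) T_(j+1) = (D (x) D) (b g)^i (g b)^j (A (x) A) + (q - q^-1) Z_(i+j+1)],
  where the correction Z_n satisfies [g Z_n = C (x) T_(n+1)] and
  [Z_n g = T_(n+1) (x) C].  So the corrections cancel the summand l = p, and what is
  left is an identity between words in b and g, which holds because
  [b^2 = B (x) B] commutes with g and [g^2 = 1 + (q - q^-1) g]. *)
Require Import Defs.
From mathcomp Require Import all_boot all_order all_algebra.
From mathcomp Require Import reals.
From mathcomp.real_closed Require Import complex mxtens.
Set Implicit Arguments.
Unset Strict Implicit.
Unset Printing Implicit Defensive.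
Import GRing.Theory.
Local Open Scope ring_scope.

(** * Matrices indexed by pairs and the flip of two tensor factors *)

Lemma tens_matrixP (S : Type) (a b c d : nat) (X Y : 'M[S]_(a * b, c * d)) :
  (forall i j k l, X (mxtens_index (i, j)) (mxtens_index (k, l))
                 = Y (mxtens_index (i, j)) (mxtens_index (k, l))) -> X = Y.
Proof.
move=> XY; apply/matrixP => x y.
by case: (mxtens_indexP x) => i j; case: (mxtens_indexP y) => k l.
Qed.

Lemma eq_mxtens_index (a b : nat) (i i' : 'I_a) (j j' : 'I_b) :
  (mxtens_index (i, j) == mxtens_index (i', j')) = (i == i') && (j == j').
Proof. by rewrite (can_eq (@mxtens_indexK a b)). Qed.

Section Swap.
Variable S : pzRingType.

(** The flip from $V_b\otimes V_a$ to $V_a\otimes V_b$. It is $P$ when [a = b]; unequal sizes occur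
    because the blocks of $\mathcal M$ are rectangular. *)
Definition swap_mx (a b : nat) : 'M[S]_(a * b, b * a) :=
  \matrix_(x, y) (mxtens_unindex x == ((mxtens_unindex y).2, (mxtens_unindex y).1))%:R.

Lemma mul_swap_mxE (a b n : nat) (X : 'M[S]_(b * a, n)) i j y :
  (swap_mx a b *m X) (mxtens_index (i, j)) y = X (mxtens_index (j, i)) y.
Proof.
rewrite mxE (bigD1 (mxtens_index (j, i))) //= big1 => [|x xNji].
  by rewrite mxE !mxtens_indexK eqxx mul1r addr0.
rewrite mxE mxtens_indexK; case: eqP => [ijE|]; last by rewrite mul0r.
case/eqP: xNji; rewrite -[x]mxtens_unindexK.
by case: (mxtens_unindex x) ijE => x1 x2 [-> ->].
Qed.

Lemma mulmx_swapE (a b n : nat) (X : 'M[S]_(n, a * b)) x i j :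
  (X *m swap_mx a b) x (mxtens_index (j, i)) = X x (mxtens_index (i, j)).
Proof.
rewrite mxE (bigD1 (mxtens_index (i, j))) //= big1 => [|y yNij].
  by rewrite mxE !mxtens_indexK eqxx mulr1 addr0.
rewrite mxE mxtens_indexK; case: eqP => [ijE|]; last by rewrite /= mulr0.
case/eqP: yNij; rewrite -[y]mxtens_unindexK ijE.
by case: (mxtens_unindex y).
Qed.

Lemma swap_mxK (a b : nat) : swap_mx a b *m swap_mx b a = 1%:M.
Proof.
apply: tens_matrixP => i j k l.
rewrite mul_swap_mxE !mxE !mxtens_indexK /= eq_mxtens_index xpair_eqE.
by rewrite andbC.
Qed.

End Swap.

(** * Operators on one tensor leg over a noncommutative ring *)

Section Legs.
Variables (C : fieldType) (Q : unitAlgType C).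

Lemma leg1E (k a b : nat) (A : 'M[Q]_(a, b)) i j i' j' :
  leg1 k A (mxtens_index (i, j)) (mxtens_index (i', j')) = A i i' *+ (j == j').
Proof. by rewrite tensmxE mxE mulr_natr. Qed.

Lemma leg2E (k a b : nat) (A : 'M[Q]_(a, b)) i j i' j' :
  leg2 k A (mxtens_index (j, i)) (mxtens_index (j', i')) = A i i' *+ (j == j').
Proof. by rewrite tensmxE mxE mulr_natl. Qed.

Lemma sum_mxtens_index (a b : nat) (F : 'I_(a * b) -> Q) :
  \sum_x F x = \sum_i \sum_j F (mxtens_index (i, j)).
Proof.
rewrite pair_big (reindex (@mxtens_index a b)) /=; last first.
  by exists (@mxtens_unindex a b) => x _; rewrite ?mxtens_indexK ?mxtens_unindexK.
by apply: eq_bigr => -[i j].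
Qed.

Lemma sum_mulrb_eq (I : finType) (F : I -> Q) i :
  \sum_j F j *+ (i == j) = F i.
Proof.
rewrite (bigD1 i) //= eqxx mulr1n big1 ?addr0 // => j jNi.
by rewrite eq_sym (negPf jNi).
Qed.

Lemma prod12E (a b c d : nat) (A : 'M[Q]_(a, b)) (B : 'M[Q]_(c, d)) i j k l :
  prod12 A B (mxtens_index (i, j)) (mxtens_index (k, l)) = A i k * B j l.
Proof.
rewrite mxE sum_mxtens_index.
under eq_bigr => i' _.
  under eq_bigr => j' _ do rewrite leg1E leg2E mulrnAl.
  rewrite sum_mulrb_eq mulrnAr eq_sym; over.
by rewrite (sum_mulrb_eq (fun i' => A i i' * B j l)).
Qed.

Lemma prod21E (a b c d : nat) (A : 'M[Q]_(a, b)) (B : 'M[Q]_(c, d)) i j k l :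
  prod21 B A (mxtens_index (i, j)) (mxtens_index (k, l)) = B j l * A i k.
Proof.
rewrite mxE sum_mxtens_index exchange_big /=.
under eq_bigr => j' _.
  under eq_bigr => i' _ do rewrite leg1E leg2E mulrnAl.
  rewrite sum_mulrb_eq mulrnAr eq_sym; over.
by rewrite (sum_mulrb_eq (fun j' => B j j' * A i k)).
Qed.

(** The other leg carries an identity matrix, so no two entries of [Q] have to be exchanged. The
    mixed-product rule for general Kronecker products fails over a noncommutative [Q]. *)
Lemma leg1_mul (k a b c : nat) (A : 'M[Q]_(a, b)) (B : 'M[Q]_(b, c)) :
  leg1 k (A *m B) = leg1 k A *m leg1 k B.
Proof.
apply: tens_matrixP => i j i' j'.
rewrite leg1E !mxE sum_mxtens_index -sumrMnl; apply: eq_bigr => x _.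
under eq_bigr => y _ do rewrite !leg1E mulrnAl.
by rewrite sum_mulrb_eq mulrnAr.
Qed.

Lemma leg2_mul (k a b c : nat) (A : 'M[Q]_(a, b)) (B : 'M[Q]_(b, c)) :
  leg2 k (A *m B) = leg2 k A *m leg2 k B.
Proof.
apply: tens_matrixP => i j i' j'.
rewrite leg2E !mxE sum_mxtens_index exchange_big -sumrMnl; apply: eq_bigr => x _.
under eq_bigr => y _ do rewrite !leg2E mulrnAl.
by rewrite sum_mulrb_eq mulrnAr.
Qed.

Lemma leg1_1 (k a : nat) : leg1 k (1%:M : 'M[Q]_a) = 1%:M.
Proof.
apply: tens_matrixP => i j i' j'.
by rewrite leg1E !mxE eq_mxtens_index -mulrnA mulnb.
Qed.

Lemma leg2_1 (k a : nat) : leg2 k (1%:M : 'M[Q]_a) = 1%:M.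
Proof.
apply: tens_matrixP => i j i' j'.
by rewrite leg2E !mxE eq_mxtens_index -mulrnA mulnb andbC.
Qed.

Lemma leg1_swap (k a b : nat) (A : 'M[Q]_(a, b)) :
  leg1 k A *m swap_mx Q b k = swap_mx Q a k *m leg2 k A.
Proof.
apply: tens_matrixP => i j i' j'.
by rewrite mul_swap_mxE mulmx_swapE leg1E leg2E.
Qed.

Lemma leg2_swap (k a b : nat) (A : 'M[Q]_(a, b)) :
  leg2 k A *m swap_mx Q k b = swap_mx Q k a *m leg1 k A.
Proof.
apply: tens_matrixP => i j i' j'.
by rewrite mul_swap_mxE mulmx_swapE leg1E leg2E.
Qed.

Lemma prod21_swap (a b c d : nat) (A : 'M[Q]_(a, b)) (B : 'M[Q]_(c, d)) :
  prod21 B A = swap_mx Q a c *m prod12 B A *m swap_mx Q d b.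
Proof.
apply: tens_matrixP => i j k l.
by rewrite mulmx_swapE mul_swap_mxE prod12E prod21E.
Qed.

(** The factor [c%:A] is central in [Q]; an arbitrary element of [Q] could not be pulled out on the
    left. *)
Lemma mulmx_algr (a1 a2 a3 : nat) (X : 'M[Q]_(a1, a2)) (c : C) (Y : 'M[Q]_(a2, a3)) :
  X *m (c%:A *: Y) = c%:A *: (X *m Y).
Proof.
apply/matrixP => i j; rewrite !mxE mulr_sumr; apply: eq_bigr => k _.
by rewrite !mxE !mulr_algl scalerAr.
Qed.

End Legs.

(** * Entries of $R$ and the Hecke relation for $g = PR$ *)

Section RMatrix.
Variables (C : fieldType) (Q : unitAlgType C) (q : C).

(** The first two sums of $R$ merge: $1 + (q - 1) = q$ when [i == j], and $1$ otherwise. *)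
Lemma RmxE (n : nat) (i j k l : 'I_n) :
  Rmx q n (mxtens_index (i, j)) (mxtens_index (k, l)) =
    q ^+ (i == j) *+ ((i == k) && (j == l))
    + (q - q^-1) *+ [&& (j < i)%N, i == l & j == k].
Proof.
rewrite !mxE !summxE; congr (_ + _).
  rewrite (bigD1 i) //= summxE (bigD1 j) //= tensmxE !mxE !eqxx /=.
  rewrite big1 => [|j' j'j]; last by rewrite tensmxE !mxE (eq_sym j) (negPf j'j) /= mulr0.
  rewrite addr0 big1 => [|i' i'i]; last first.
    rewrite summxE big1 // => j' _.
    by rewrite tensmxE !mxE (eq_sym i) (negPf i'i) /= mul0r.
  rewrite (bigD1 i) //= tensmxE !mxE eqxx /= big1 => [|i' i'i]; last first.
    by rewrite tensmxE !mxE (eq_sym i) (negPf i'i) /= mul0r.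
  rewrite !addr0 -!natrM !mulnb (eq_sym k) (eq_sym l) (eq_sym j i).
  have [<-|ij] := eqVneq i j; last by rewrite andbF mulr0 addr0.
  rewrite /= mulrBl mul1r mulr_natr (eq_sym l).
  by rewrite addrC subrK.
rewrite -mulr_natr; congr (_ * _).
rewrite (bigD1 i) //= summxE [X in _ + X]big1 => [|i' i'i]; last first.
  rewrite summxE big1 // => j' _.
  by rewrite tensmxE !mxE (eq_sym i) (negPf i'i) /= mul0r.
rewrite addr0.
have [ji|ij] := boolP (j < i)%N.
  rewrite (bigD1 j) //= tensmxE !mxE !eqxx /= big1 => [|j' /andP[_ j'j]]; last first.
    by rewrite tensmxE !mxE (eq_sym j) (negPf j'j) /= mulr0.
  by rewrite addr0 -natrM mulnb andbC (eq_sym k) (eq_sym l).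
rewrite big1 // => j' j'i; rewrite tensmxE !mxE.
case: (eqVneq j j') => [jj'|]; last by rewrite /= mulr0.
by rewrite jj' j'i in ij.
Qed.

Lemma sum_mulrb_eq2 (I J : finType) (F : I -> J -> Q) i j :
  \sum_k \sum_l F k l *+ ((i == k) && (j == l)) = F i j.
Proof.
under eq_bigr => k _.
  under eq_bigr => l _ do rewrite andbC -mulnb mulrnA.
  rewrite sumrMnl sum_mulrb_eq; over.
exact: sum_mulrb_eq.
Qed.

Lemma scalar_entries_Rmx_mulE (n p : nat) (X : 'M[Q]_(n * n, p)) i j y :
  (scalar_entries Q (Rmx q n) *m X) (mxtens_index (i, j)) y =
    q ^+ (i == j) *: X (mxtens_index (i, j)) y
    + (q - q^-1) *: X (mxtens_index (j, i)) y *+ (j < i)%N.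
Proof.
rewrite mxE sum_mxtens_index.
(* Both terms on the right become double sums with indicator factors, so that the two sides can be
   compared summand by summand. *)
have -> : q ^+ (i == j) *: X (mxtens_index (i, j)) y =
    \sum_k \sum_l (q ^+ (i == j) *: X (mxtens_index (k, l)) y) *+ ((i == k) && (j == l)).
  by rewrite sum_mulrb_eq2.
have -> : (q - q^-1) *: X (mxtens_index (j, i)) y *+ (j < i)%N =
    \sum_k \sum_l ((q - q^-1) *: X (mxtens_index (k, l)) y *+ (j < i)%N)
       *+ ((j == k) && (i == l)).
  by rewrite sum_mulrb_eq2.
rewrite -big_split; apply: eq_bigr => k _; rewrite -big_split; apply: eq_bigr => l _.
rewrite mxE RmxE mulr_algl scalerDl -!scalerMnl /=; congr (_ + _).
by rewrite -mulrnA mulnb (andbC (j == k)).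
Qed.

Lemma mulmx_scalar_entries_RmxE (n p : nat) (X : 'M[Q]_(p, n * n)) x k l :
  (X *m scalar_entries Q (Rmx q n)) x (mxtens_index (k, l)) =
    q ^+ (k == l) *: X x (mxtens_index (k, l))
    + (q - q^-1) *: X x (mxtens_index (l, k)) *+ (k < l)%N.
Proof.
rewrite mxE sum_mxtens_index.
have -> : q ^+ (k == l) *: X x (mxtens_index (k, l)) =
    \sum_i \sum_j (q ^+ (i == j) *: X x (mxtens_index (i, j))) *+ ((k == i) && (l == j)).
  by rewrite sum_mulrb_eq2.
have -> : (q - q^-1) *: X x (mxtens_index (l, k)) *+ (k < l)%N =
    \sum_i \sum_j ((q - q^-1) *: X x (mxtens_index (i, j)) *+ (j < i)%N)
       *+ ((l == i) && (k == j)).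
  by rewrite sum_mulrb_eq2.
rewrite -big_split; apply: eq_bigr => i _; rewrite -big_split; apply: eq_bigr => j _.
rewrite mxE RmxE mulr_algr scalerDl -!scalerMnl /= (eq_sym k) (eq_sym l j).
congr (_ + _); by rewrite -mulrnA mulnb (eq_sym l) (eq_sym k).
Qed.

Definition braid (n : nat) : 'M[Q]_(n * n) :=
  swap_mx Q n n *m scalar_entries Q (Rmx q n).

Lemma braid_mulE (n p : nat) (X : 'M[Q]_(n * n, p)) i j y :
  (braid n *m X) (mxtens_index (i, j)) y =
    q ^+ (i == j) *: X (mxtens_index (j, i)) y
    + (q - q^-1) *: X (mxtens_index (i, j)) y *+ (i < j)%N.
Proof. by rewrite -mulmxA mul_swap_mxE scalar_entries_Rmx_mulE eq_sym. Qed.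

Lemma mulmx_braidE (n p : nat) (X : 'M[Q]_(p, n * n)) x k l :
  (X *m braid n) x (mxtens_index (k, l)) =
    q ^+ (k == l) *: X x (mxtens_index (l, k))
    + (q - q^-1) *: X x (mxtens_index (k, l)) *+ (k < l)%N.
Proof. by rewrite mulmxA mulmx_scalar_entries_RmxE !mulmx_swapE. Qed.

(** On $e_i\otimes e_i$, $g$ is the scalar $q$, and $q^2 = 1 + (q - q^{-1})q$. For $i<j$, on
    $e_i\otimes e_j$ and $e_j\otimes e_i$, it is a symmetric block with off-diagonal entries $1$ and
    diagonal entries $q - q^{-1}$, $0$. *)
Lemma braid_sqr (n : nat) : q != 0 ->
  braid n *m braid n = 1%:M + (q - q^-1)%:A *: braid n.
Proof.
move=> q_neq0; apply: tens_matrixP => i j k l.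
rewrite braid_mulE.
have brE i' j' := braid_mulE (1%:M : 'M[Q]_(n * n)) i' j' (mxtens_index (k, l)).
rewrite mulmx1 in brE; rewrite !brE [RHS]mxE [X in _ = _ + X]mxE brE !mxE !eq_mxtens_index.
rewrite mulr_algl (eq_sym j i).
have [<-|ij] := eqVneq i j.
  rewrite ltnn !mulr0n !addr0 /= !scalerA.
  rewrite -[X in _ = X + _]scale1r -scalerDl expr1 mulrBl mulVf //.
  by rewrite addrC subrK.
rewrite expr0 !scale1r; case: ltngtP => [_|_|/val_inj/eqP].
- by rewrite !mulr1n !mulr0n !addr0.
- by rewrite !mulr1n !mulr0n addr0.
- by rewrite eq_sym (negPf ij).
Qed.

Lemma scalar_entries_Pmx (c : C) (n : nat) :
  scalar_entries Q (c *: Pmx C n) = c%:A *: swap_mx Q n n.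
Proof.
apply: tens_matrixP => i j k l; rewrite !mxE !mxtens_indexK summxE /=.
rewrite (bigD1 i) //= summxE (bigD1 j) //= tensmxE !mxE !eqxx /=.
rewrite big1 => [|j' j'j]; last by rewrite tensmxE !mxE (eq_sym j) (negPf j'j) /= mulr0.
rewrite big1 => [|i' i'i]; last first.
  rewrite summxE big1 // => j' _.
  by rewrite tensmxE !mxE (eq_sym i) (negPf i'i) /= mul0r.
rewrite !addr0 -natrM mulnb xpair_eqE (eq_sym k) (eq_sym l) andbC.
by case: (_ && _); rewrite /= ?mulr1 // !mulr0 scale0r.
Qed.

End RMatrix.

(** * The word identity in an abstract ring with a central element [a] *)

Section BraidWords.
Variables (S : pzRingType) (b g a : S).
Hypotheses (aC : forall x, a * x = x * a) (gbb : g * (b * b) = b * b * g)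
  (gg : g * g = 1 + a * g).

Lemma expr_mul_comm (x y : S) n : (x * y) ^+ n * x = x * (y * x) ^+ n.
Proof.
elim: n => [|n IHn]; first by rewrite !expr0 mul1r mulr1.
by rewrite exprSr -!mulrA mulrA IHn -mulrA -exprSr.
Qed.

Lemma bb_comm : GRing.comm (b * b) (b * g).
Proof. by apply: commrM; rewrite /GRing.comm ?gbb ?mulrA. Qed.

(* [(b * g) ^+ n * b] is a palindrome, so both sides of [braid_word_sym] pick up the
  same contribution from it. *)
Lemma braid_word_rec i j :
  (b * g) ^+ i.+1 * (g * b) ^+ j.+1 =
    b * b * ((b * g) ^+ i * (g * b) ^+ j) + a * ((b * g) ^+ (i + j).+1 * b).
Proof.
rewrite (exprSr _ i) (exprS _ j).
(* The two powers meet in [b * (g * g) * b]. The term [1] of [g * g] leaves [b * b], which moves to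
   the front; the term [a * g] leaves [b * g * b], which joins the powers into one alternating
   word. *)
transitivity ((b * g) ^+ i * (b * (g * g) * b) * (g * b) ^+ j); first by rewrite !mulrA.
rewrite gg mulrDr mulr1 mulrDl mulrDr mulrDl (mulrA (b * b)) (commrX i bb_comm).
congr (_ + _).
rewrite -addSn exprD -!mulrA expr_mul_comm (mulrA a) aC exprSr -!mulrA aC.
by rewrite [RHS]aC -!mulrA.
Qed.

(** Induction lowering [i] and [j] together: [braid_word_rec] turns every product with both
    exponents positive into [b * b] times the one for the smaller pair, plus a multiple of the
    palindrome. *)
Lemma braid_word_sym i j : (j <= i)%N ->
  g * ((b * g) ^+ i * (g * b) ^+ j)
  + \sum_(1 <= l < j.+1) a * ((b * g) ^+ (i + l) * (g * b) ^+ (j - l)) =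
  (b * g) ^+ j * (g * b) ^+ i * g
  + \sum_(1 <= l < j.+1) a * ((b * g) ^+ (j - l) * (g * b) ^+ (i + l)).
Proof.
elim: j i => [|j IHj] [|i] //= le_ji.
- by rewrite !big_geq // !expr0 !mulr1 mul1r.
- by rewrite !big_geq // !expr0 !mulr1 mul1r -expr_mul_comm.
have /IHj {}IHj := le_ji.
rewrite !braid_word_rec [in LHS]big_nat_recr //= [in RHS]big_nat_recr //=.
rewrite !subnn !expr0 !mulr1 !mul1r.
set s := (b * g) ^+ (i + j).+1 * b.
(* [g * s] is the top summand of the right-hand sum and [s * g] that of the left-hand sum, so both
   sides carry [a * (g * s + s * g)]. *)
have gs : g * s = (g * b) ^+ (i + j).+2 by rewrite /s mulrA -expr_mul_comm -mulrA -exprSr.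
have sg : s * g = (b * g) ^+ (i + j).+2 by rewrite /s -mulrA -exprSr.
have sumE F G : (forall l, (1 <= l < j.+1)%N -> F l = b * b * G l + a * s) ->
    \sum_(1 <= l < j.+1) a * F l =
    b * b * (\sum_(1 <= l < j.+1) a * G l) + \sum_(1 <= l < j.+1) a * (a * s).
  move=> FG; rewrite mulr_sumr -big_split; apply: eq_big_nat => l /FG ->.
  by rewrite mulrDr [a * (b * b * _)]mulrA [a * (b * b)]aC -!mulrA.
(* The exponents add up to [i + j] for every [l], so each remaining summand produces the same
   [s]. *)
have [lE1 lE2] : (forall l, (1 <= l < j.+1)%N -> (i + l + (j - l)) = i + j)%N
                 /\ (forall l, (1 <= l < j.+1)%N -> (j - l + (i + l)) = i + j)%N.
  split=> l /andP[_ lj]; first by rewrite -addnA subnKC.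
  by rewrite addnC -addnA subnKC.
rewrite (sumE _ (fun l => (b * g) ^+ (i + l) * (g * b) ^+ (j - l))); last first.
  by move=> l lj; rewrite addSn subSn ?braid_word_rec ?lE1 //; case/andP: lj.
rewrite [in RHS](sumE _ (fun l => (b * g) ^+ (j - l) * (g * b) ^+ (i + l))); last first.
  by move=> l lj; rewrite addSn subSn ?braid_word_rec ?lE2 //; case/andP: lj.
rewrite (addnC j i) -/s addSn addnS -gs -sg.
rewrite mulrDr mulrDl (mulrA g (b * b)) gbb -(mulrA (b * b) g) -(mulrA (b * b) _ g).
rewrite (mulrA g a) -aC -!(mulrA a).
rewrite [in LHS]addrACA [in RHS]addrACA -!(mulrDr a) (addrC (g * s)).
by rewrite !(addrA (b * b * _)) -!mulrDr IHj.
Qed.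

End BraidWords.

(** * Exchange relations between the blocks of $\mathcal M$ *)

Section BlockRelations.
Variables (C : fieldType) (Q : unitAlgType C) (q : C) (m n1 n2 : nat).
Variable M : 'M[Q]_(m + n2, n1 + m).
Hypothesis M_RTT : RTT q M.

Local Notation A := (ulsubmx M).
Local Notation B := (ursubmx M).
Local Notation C0 := (dlsubmx M).
Local Notation D := (drsubmx M).
Local Notation Rq n := (scalar_entries Q (Rmx q n)).
Local Notation g n := (braid Q q n).
Local Notation sw := (swap_mx Q).
Local Notation la := ((q - q^-1)%:A : Q).

(** Reading the hypothesis in row [(j, i)] gives entry [(i, j), (k, l)] of $g(\mathcal
    M\otimes\mathcal M) = (\mathcal M\otimes\mathcal M)g$. The block relations place each index in a
    block; indices in different blocks are unequal and their order is known. *)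
Lemma RTT_entries i j k l :
  q ^+ (i == j) *: (M j k * M i l) + (q - q^-1) *: (M i k * M j l) *+ (i < j)%N =
  q ^+ (k == l) *: (M i l * M j k) + (q - q^-1) *: (M i k * M j l) *+ (k < l)%N.
Proof.
have /matrixP/(_ (mxtens_index (j, i)) (mxtens_index (k, l))) := M_RTT.
by rewrite scalar_entries_Rmx_mulE mulmx_scalar_entries_RmxE !prod12E !prod21E eq_sym.
Qed.

Let ltn_lr (a b : nat) (i : 'I_a) (j : 'I_b) : (lshift b i < rshift a j)%N.
Proof. by rewrite /= ltn_addr. Qed.

Let ltn_rl (a b : nat) (i : 'I_a) (j : 'I_b) : (rshift a j < lshift b i)%N = false.
Proof. by apply/negbTE; rewrite -leqNgt ltnW. Qed.

Let shiftE := (eq_lshift, eq_rshift, eq_lrshift, eq_rlshift).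

Lemma braid_AA : g m *m prod12 A A = prod12 A A *m g n1.
Proof.
apply: tens_matrixP => i j k l; rewrite braid_mulE mulmx_braidE !prod12E !mxE.
by have := RTT_entries (lshift _ i) (lshift _ j) (lshift _ k) (lshift _ l); rewrite !shiftE.
Qed.

Lemma braid_BB : g m *m prod12 B B = prod12 B B *m g m.
Proof.
apply: tens_matrixP => i j k l; rewrite braid_mulE mulmx_braidE !prod12E !mxE.
have := RTT_entries (lshift _ i) (lshift _ j) (rshift _ k) (rshift _ l).
by rewrite !shiftE /= ltn_add2l.
Qed.

Lemma braid_CC : g n2 *m prod12 C0 C0 = prod12 C0 C0 *m g n1.
Proof.
apply: tens_matrixP => i j k l; rewrite braid_mulE mulmx_braidE !prod12E !mxE.
have := RTT_entries (rshift _ i) (rshift _ j) (lshift _ k) (lshift _ l).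
by rewrite !shiftE /= ltn_add2l.
Qed.

Lemma braid_DD : g n2 *m prod12 D D = prod12 D D *m g m.
Proof.
apply: tens_matrixP => i j k l; rewrite braid_mulE mulmx_braidE !prod12E !mxE.
have := RTT_entries (rshift _ i) (rshift _ j) (rshift _ k) (rshift _ l).
by rewrite !shiftE /= !ltn_add2l.
Qed.

(** The column [k] lies in the later block and [l] in the earlier one, so [k < l] fails and $g$ on
    the right reduces to a flip. *)
Lemma braid_DC : g n2 *m prod12 D C0 = prod12 C0 D *m sw n1 m.
Proof.
apply: tens_matrixP => i j k l; rewrite braid_mulE mulmx_swapE !prod12E !mxE.
have := RTT_entries (rshift _ i) (rshift _ j) (rshift _ k) (lshift _ l).
by rewrite !shiftE ltn_rl /= ltn_add2l expr0 scale1r mulr0n addr0.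
Qed.

Lemma braid_BA : g m *m prod12 B A = prod12 A B *m sw n1 m.
Proof.
apply: tens_matrixP => i j k l; rewrite braid_mulE mulmx_swapE !prod12E !mxE.
have := RTT_entries (lshift _ i) (lshift _ j) (rshift _ k) (lshift _ l).
by rewrite !shiftE ltn_rl /= expr0 scale1r mulr0n addr0.
Qed.

Lemma prod12_AC : prod12 A C0 = prod21 C0 A *m Rq n1.
Proof.
apply: tens_matrixP => j i k l; rewrite mulmx_scalar_entries_RmxE prod12E !prod21E !mxE.
have := RTT_entries (rshift _ i) (lshift _ j) (lshift _ k) (lshift _ l).
by rewrite !shiftE ltn_rl /= expr0 scale1r mulr0n addr0.
Qed.

Lemma prod12_BD : prod12 B D = prod21 D B *m Rq m.
Proof.
apply: tens_matrixP => j i k l; rewrite mulmx_scalar_entries_RmxE prod12E !prod21E !mxE.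
have := RTT_entries (rshift _ i) (lshift _ j) (rshift _ k) (rshift _ l).
by rewrite !shiftE ltn_rl /= ltn_add2l expr0 scale1r mulr0n addr0.
Qed.

Lemma prod12_BC : prod12 B C0 = prod21 C0 B.
Proof.
apply: tens_matrixP => j i k l; rewrite prod12E prod21E !mxE.
have := RTT_entries (rshift _ i) (lshift _ j) (rshift _ k) (lshift _ l).
by rewrite !shiftE !ltn_rl /= expr0 !scale1r !mulr0n !addr0.
Qed.

(** Here [k < l] always holds, so the term with $q - q^{-1}$ survives; it is the source of
    [correction]. *)
Lemma prod12_AD : prod12 A D = prod21 D A + la *: (prod21 C0 B *m sw m n1).
Proof.
apply: tens_matrixP => j i k l; rewrite prod12E [RHS]mxE [X in _ = _ + X]mxE.
rewrite mulmx_swapE !prod21E !mxE mulr_algl.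
have := RTT_entries (rshift _ i) (lshift _ j) (lshift _ k) (rshift _ l).
by rewrite !shiftE !ltn_rl ltn_lr /= expr0 !scale1r !mulr0n !mulr1n !addr0.
Qed.

(** * Products of level matrices as words in [b] and $g$ *)

Definition B1swap : 'M[Q]_(m * m) := leg1 m B *m sw m m.
Local Notation b := B1swap.

Lemma B1swap_sqr : b *m b = prod12 B B.
Proof. by rewrite /b mulmxA -(mulmxA (leg1 m B)) -leg2_swap -!mulmxA swap_mxK mulmx1. Qed.

Lemma swap_braid n : sw n n *m g n = Rq n.
Proof. by rewrite mulmxA swap_mxK mul1mx. Qed.

Lemma B1swap_braid : b *m g m = leg1 m B *m Rq m.
Proof. by rewrite -mulmxA swap_braid. Qed.

Lemma leg1_exp k i : leg1 k (B ^+ i.+1) = leg1 k (B ^+ i) *m leg1 k B.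
Proof. by rewrite exprSr -leg1_mul. Qed.

(** By [prod12_BD], a factor $B$ passing $D$ picks up $R$ on its right, and $B$ in leg 1 times $R$
    is [b] times $g$. *)
Lemma B_exp_D i : leg1 n2 (B ^+ i) *m leg2 m D = leg2 m D *m (b *m g m) ^+ i.
Proof.
elim: i => [|i IHi]; first by rewrite !expr0 leg1_1 mul1mx mulmx1.
rewrite leg1_exp -mulmxA [leg1 n2 B *m _]prod12_BD -mulmxA -B1swap_braid.
by rewrite mulmxA IHi -mulmxA exprSr.
Qed.

Lemma prod12_AB : prod12 A B = g m *m b *m leg1 m A.
Proof.
rewrite -[LHS]mulmx1 -(swap_mxK Q n1 m) mulmxA -braid_BA.
by rewrite -!mulmxA leg2_swap.
Qed.

Lemma A_B_exp j : leg1 m A *m leg2 n1 (B ^+ j) = (g m *m b) ^+ j *m leg1 m A.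
Proof.
elim: j => [|j IHj]; first by rewrite !expr0 leg2_1 mul1mx mulmx1.
by rewrite exprSr leg2_mul mulmxA IHj -mulmxA [leg1 m A *m _]prod12_AB mulmxA exprSr.
Qed.

Lemma B_exp_C i : leg1 n2 (B ^+ i) *m leg2 m C0 = leg2 m C0 *m leg1 n1 (B ^+ i).
Proof.
elim: i => [|i IHi]; first by rewrite !expr0 !leg1_1 mul1mx mulmx1.
by rewrite !leg1_exp -mulmxA [leg1 n2 B *m _]prod12_BC !mulmxA IHi.
Qed.

(** Entry [(x, y), (k, l)] is $\sum_a D_{xa}C_{yk}(B^iA)_{al}$: an entry of $T_{i+1}$ with an entry
    of $C$ inserted after $D$. *)
Definition correction i : 'M[Q]_(n2 * n2, n1 * n1) :=
  prod12 D C0 *m sw m n1 *m leg2 n1 (B ^+ i *m A).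

Local Notation T := (level_transport M).

Lemma prod12_level i j :
  prod12 (T i.+1) (T j.+1) =
    prod12 D D *m ((b *m g m) ^+ i *m (g m *m b) ^+ j) *m prod12 A A
    + la *: correction (i + j).+1.
Proof.
rewrite {1}/prod12 /level_transport !leg1_mul !leg2_mul.
(* Only the inner $A$ of the first factor and the $D$ of the second are out of order; [prod12_AD]
   exchanges them and splits the product in two. *)
rewrite -!mulmxA (mulmxA (leg1 n2 A)) [leg1 n2 A *m _]prod12_AD mulmxDl !mulmxDr.
congr (_ + _).
  rewrite (mulmxA (leg1 n2 _) (leg2 m D *m _)) (mulmxA (leg1 n2 _) (leg2 m D)) B_exp_D.
  by rewrite -!mulmxA (mulmxA (leg1 m A)) A_B_exp -!mulmxA.
rewrite -scalemxAl !mulmx_algr; congr (_ *: _).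
(* In the extra term the powers of $B$ pass $C$ unchanged, and the flip brings them all to one leg;
   only the total power is left. *)
rewrite /correction -addSn exprD !leg2_mul /prod12 /prod21 -!mulmxA.
rewrite (mulmxA (leg1 n2 (B ^+ i))) B_exp_C -mulmxA (mulmxA (leg1 n1 (B ^+ i))) -leg1_exp.
by rewrite (mulmxA (leg1 n1 (B ^+ i.+1))) leg1_swap -mulmxA.
Qed.

Lemma braid_correction i : g n2 *m correction i = prod12 C0 (T i.+1).
Proof.
rewrite /correction (mulmxA (g n2)) (mulmxA (g n2) (prod12 D C0)) braid_DC.
rewrite -(mulmxA (prod12 C0 D)) swap_mxK mulmx1.
by rewrite /prod12 -mulmxA -!leg2_mul !mulmxA.
Qed.

(** The flip inside [correction] meets $g$ and produces $R$, which [prod12_AC] absorbs when $A$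
    passes $C$. *)
Lemma correction_braid i : correction i *m g n1 = prod12 (T i.+1) C0.
Proof.
rewrite /correction -!mulmxA (mulmxA (sw m n1)) -leg1_swap -(mulmxA _ _ (g n1)) swap_braid.
rewrite /prod12 leg1_mul -mulmxA (mulmxA (leg2 m C0)) -B_exp_C -!mulmxA.
have -> : leg2 m C0 *m (leg1 n1 A *m Rq n1) = leg1 n2 A *m leg2 n1 C0.
  by rewrite [RHS]prod12_AC -mulmxA.
by rewrite /level_transport !leg1_mul !mulmxA.
Qed.

(** For positive [k] both sides equal [correction] multiplied by $g$ on the left and on the
    right. *)
Lemma level_braid_0 k : g n2 *m prod12 (T k) (T 0%N) = prod12 (T 0%N) (T k) *m g n1.
Proof.
case: k => [|i]; first exact: braid_CC.
by rewrite -correction_braid mulmxA braid_correction.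
Qed.

Lemma level_braid k p : q != 0 -> (p <= k)%N ->
  g n2 *m prod12 (T k) (T p)
  + la *: \sum_(1 <= l < p.+1) prod12 (T (k + l)%N) (T (p - l)%N) =
  prod12 (T p) (T k) *m g n1
  + la *: \sum_(1 <= l < p.+1) prod12 (T (p - l)%N) (T (k + l)%N).
Proof.
(* [p = 0] is separate because $T_0$ has no factorization through $D$ and $A$. *)
move=> q_neq0; case: p => [|j]; first by rewrite !big_geq // level_braid_0.
case: k => // i le_ji; have {}le_ji : (j <= i)%N := le_ji.
have bg_la x : la%:M * x = x * la%:M :> 'M[Q]_(m * m).
  by rewrite -!mulmxE mul_scalar_mx -scalemx1 mulmx_algr mulmx1.
have g_bb : g m * (b * b) = b * b * g m by rewrite -!mulmxE B1swap_sqr braid_BB.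
have g_sqr : g m * g m = 1 + la%:M * g m by rewrite -!mulmxE braid_sqr // mul_scalar_mx.
have := braid_word_sym bg_la g_bb g_sqr le_ji.
(* By [braid_DD] and [braid_AA], [W] carries $g$ of size [m] to $g$ of size [n2] on the left and of
   size [n1] on the right, so it transports the word identity. *)
pose W (X : 'M[Q]_(m * m)) := prod12 D D *m X *m prod12 A A.
have WD X Y : W (X + Y) = W X + W Y by rewrite /W mulmxDr mulmxDl.
have Wla X : W (la%:M * X) = la *: W X.
  by rewrite /W -mulmxE mul_scalar_mx mulmx_algr scalemxAl.
have Wg X : W (g m * X) = g n2 *m W X.
  by rewrite /W -mulmxE mulmxA -braid_DD !mulmxA.
have WXg X : W (X * g m) = W X *m g n1.
  rewrite /W -mulmxE (mulmxA (prod12 D D)) -(mulmxA (prod12 D D *m X)) braid_AA.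
  by rewrite (mulmxA (prod12 D D *m X)).
have WE i' j' : prod12 (T i'.+1) (T j'.+1) =
    W ((b * g m) ^+ i' * (g m * b) ^+ j') + la *: correction (i' + j').+1.
  exact: prod12_level.
have W_sum F : W (\sum_(1 <= l < j.+1) la%:M * F l) = la *: \sum_(1 <= l < j.+1) W (F l).
  by rewrite -mulr_sumr Wla /W mulmx_sumr mulmx_suml.
move/(congr1 W); rewrite !WD !W_sum Wg WXg => W_sym.
set Z := correction (i + j).+1.
have sumE1 : \sum_(1 <= l < j.+1) prod12 (T (i.+1 + l)%N) (T (j.+1 - l)%N) =
    \sum_(1 <= l < j.+1) W ((b * g m) ^+ (i + l) * (g m * b) ^+ (j - l))
    + \sum_(1 <= l < j.+1) la *: Z.
  rewrite -big_split; apply: eq_big_nat => l /andP[_ le_lj].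
  by rewrite addSn subSn // WE -addnA subnKC.
have sumE2 : \sum_(1 <= l < j.+1) prod12 (T (j.+1 - l)%N) (T (i.+1 + l)%N) =
    \sum_(1 <= l < j.+1) W ((b * g m) ^+ (j - l) * (g m * b) ^+ (i + l))
    + \sum_(1 <= l < j.+1) la *: Z.
  rewrite -big_split; apply: eq_big_nat => l /andP[_ le_lj].
  by rewrite addSn subSn // WE addnCA subnK.
(* The split-off summand [l = j.+1] contains $T_0$; it is [Z] times $g$ on the left-hand side and
   $g$ times [Z] on the right-hand side. With the corrections of the leading products, each side
   then has both terms. *)
rewrite ![\sum_(1 <= l < j.+2) _]big_nat_recr //= sumE1 sumE2 !subnn !WE (addnC j) -/Z.
rewrite addnS -[prod12 (T 0%N) _]braid_correction -[prod12 _ (T 0%N)]correction_braid -/Z.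
rewrite mulmxDr mulmxDl mulmx_algr -scalemxAl -!addrA !scalerDr.
rewrite [X in _ + X = _]addrCA [X in _ = _ + X]addrCA !(addrA (_ *m _)) !(addrA (_ + _)) W_sym.
rewrite -!addrA; congr (_ + (_ + _)).
by rewrite addrCA [RHS]addrCA (addrC (la *: (g n2 *m Z))).
Qed.

End BlockRelations.

(** * Return from $g$ to $R$ *)

Theorem theorem2p3 (R : realType) (q qh : R[i]) (q_neq0 : q != 0) (qhE : qh ^+ 2 = q)
    (Q : unitAlgType R[i]) (n1 m n2 : nat) (net : network (n1 + m) (m + n2))
    (omega : face_of net -> Q) (omegaP : face_variables qh omega)
    (M : 'M[Q]_(m + n2, n1 + m)) (M_transport : transport_matrix qh omega M)
    (M_RTT : RTT q M) (k p : nat) (le_pk : (p <= k)%N) :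
  let T := level_transport M in
  let Rq j : 'M[Q]_(j * j) := scalar_entries Q (Rmx q j) in
  let cP j : 'M[Q]_(j * j) := scalar_entries Q ((q - q^-1) *: Pmx R[i] j) in
  Rq n2 *m prod12 (T k) (T p)
  + cP n2 *m \sum_(1 <= l < p.+1) prod12 (T (k + l)%N) (T (p - l)%N)
  - prod21 (T p) (T k) *m Rq n1
  - (\sum_(1 <= l < p.+1) prod21 (T (p - l)%N) (T (k + l)%N)) *m cP n1 = 0.
Proof.
move=> T Rq cP.
(* Multiplying by $P$ on the left turns $g$ into $R$ and, moved through the products on the
   right-hand side, changes [prod12] into [prod21]. *)
have /(congr1 (mulmx (swap_mx Q n2 n2))) := level_braid M_RTT q_neq0 le_pk.
have prod21P (X Y : 'M[Q]_(n2, n1)) (Z : 'M[Q]_(n1 * n1)) :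
    prod21 X Y *m (swap_mx Q n1 n1 *m Z) = swap_mx Q n2 n2 *m (prod12 X Y *m Z).
  rewrite prod21_swap (mulmxA (swap_mx Q n2 n2 *m _ *m _)) -(mulmxA (swap_mx Q n2 n2 *m _)).
  by rewrite swap_mxK mulmx1 -mulmxA.
have sumP : (\sum_(1 <= l < p.+1) prod21 (T (p - l)%N) (T (k + l)%N)) *m swap_mx Q n1 n1 =
    swap_mx Q n2 n2 *m \sum_(1 <= l < p.+1) prod12 (T (p - l)%N) (T (k + l)%N).
  rewrite mulmx_suml mulmx_sumr; apply: eq_bigr => l _.
  by rewrite -[swap_mx Q n1 n1]mulmx1 prod21P mulmx1.
rewrite !mulmxDr !mulmx_algr (mulmxA _ (braid _ _ _)) swap_braid -[_ *m (prod12 _ _ *m _)]prod21P.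
rewrite swap_braid -sumP /cP !scalar_entries_Pmx mulmx_algr -scalemxAl => ->.
by rewrite addrAC addrK subrr.
Qed.
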